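(* Let $p$ be a prime and let $T\subset\mathbb{Q}_p$ be a non-empty locally finite set. Then $T$ corresponds to a uniform partition of unity if and only if there exists an integer $n$ such that \[\#\big(B(x,p^n)\cap T\big)=\#\big(B(y,p^n)\cap T\big)\quad\text{for all }x,y\in\mathbb{Q}_p.\]
   Context: $\mathbb{Q}_p$ is the field of $p$-adic numbers with Haar measure normalized so that $\mathbb{Z}_p$ has measure $1$; $B(x,p^n)=\{y\in\mathbb{Q}_p:|x-y|_p\le p^n\}$. A set $T$ is locally finite if its intersection with every compact set is finite. $T$ is said to correspond to a uniform partition of unity if there exists a non-negative function $f\in L^1(\mathbb{Q}_p)$ such that $\sum_{t\in T} f(x-t)=1$ for a.e. $x\in\mathbb{Q}_p$. *)

(* Defs.v *)
From HB Require Import structures.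
From mathcomp Require Import all_boot all_order all_algebra.
From mathcomp Require Import all_classical all_reals all_analysis.
Set Implicit Arguments. Unset Strict Implicit. Unset Printing Implicit Defensive.
Import Order.TTheory GRing.Theory Num.Theory.
Local Open Scope ring_scope.
Local Open Scope classical_set_scope.

(* A concrete model of the additive (topological) group Q_p.                 *)
(* An element x of Q_p is encoded by the sequence of its residues            *)
(*     r_k = x mod p^k Z_p  (k : nat),                                       *)
(* each represented by its canonical representative in Z[1/p] /\ [0, p^k):   *)
(* a rational with a p-power denominator in [0, p^k), and the sequence must  *)
(* be compatible: r_(k+1) - r_k is an integer multiple of p^k.  This is the  *)
(* standard identification Q_p = lim_k Q_p/p^k Z_p = lim_k Z[1/p]/p^k Z.     *)
(* As for 'Z_p in MathComp we use pp p := maxn p 2 as the modulus, so the     *)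
(* type is meaningful for every p and equals the usual one when p is prime.  *)

Definition pp (p : nat) : nat := maxn p 2.

Definition pfrac (p : nat) (q : rat) : bool := (pp p).-nat `|denq q|%N.

Definition isint (q : rat) : bool := denq q == 1.

Definition canon (p k : nat) (q : rat) : bool :=
  [&& pfrac p q, 0 <= q & q < ((pp p) ^ k)%:R].

Definition qp_seq (p : nat) (r : nat -> rat) : Prop :=
  forall k, canon p k (r k) && isint ((r k.+1 - r k) / ((pp p) ^ k)%:R).

Record Qp (p : nat) := MkQp { res : nat -> rat ; resP : qp_seq p res }.

HB.instance Definition _ p := gen_eqMixin (Qp p).
HB.instance Definition _ p := gen_choiceMixin (Qp p).

Lemma qp_seq0 p : qp_seq p (fun _ => 0).
Proof.
move=> k; rewrite /canon /pfrac /isint subrr mul0r.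
have -> : denq 0 = 1 by [].
rewrite eqxx lexx /= ltr0n expn_gt0 /pp leq_max orbT.
by [].
Qed.

Definition qp0 p : Qp p := MkQp (@qp_seq0 p).

HB.instance Definition _ p := isPointed.Build (Qp p) (qp0 p).

Definition modq (q m : rat) : rat := q - (Num.floor (q / m))%:~R * m.

Definition raw_sub p (x y : Qp p) : nat -> rat :=
  fun k => modq (res x k - res y k) ((pp p) ^ k)%:R.

(* subtraction x - y in Q_p (the fallback branch is never taken, since the  *)
(* residue sequence of x - y always satisfies qp_seq)                        *)
Definition qp_sub p (x y : Qp p) : Qp p :=
  match pselect (qp_seq p (raw_sub x y)) with
  | left h => MkQp h
  | right _ => x
  end.

(* z (given by its residue sequence) lies in p^m Z_p, i.e. |z|_p <= p^(-m) *)
Definition in_pZ (p : nat) (m : int) (z : nat -> rat) : Prop :=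
  forall k, isint (z k / ((pp p)%:R ^ m)).

(* B(x, p^n) = { y | |x - y|_p <= p^n } = { y | x - y \in p^(-n) Z_p } *)
Definition ballp p (x : Qp p) (n : int) : set (Qp p) :=
  [set y | in_pZ p (- n) (raw_sub x y)].

Definition Zp p : set (Qp p) := ballp (qp0 p) 0.

Definition openp p (U : set (Qp p)) : Prop :=
  forall x, U x -> exists n : int, ballp x n `<=` U.

Definition compactp p (K : set (Qp p)) : Prop :=
  forall (I : Type) (U : I -> set (Qp p)), (forall i, openp (U i)) ->
    K `<=` \bigcup_i U i ->
    exists F : set I, finite_set F /\ K `<=` \bigcup_(i in F) U i.

Definition locally_finite p (T : set (Qp p)) : Prop :=
  forall K, compactp K -> finite_set (K `&` T).

(* Borel sigma-algebra of Q_p: generated by the (countably many) balls *)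
Definition balls p : set (set (Qp p)) :=
  [set B | exists (x : Qp p) (n : int), B = ballp x n].

Definition QpM p := g_sigma_algebraType (@balls p).

(* Haar measure normalized by mu(Z_p) = 1: a translation invariant Borel   *)
(* measure with mu(Z_p) = 1 (such a measure is unique).                     *)
Definition haar_normalized (R : realType) p
  (mu : {measure set (QpM p) -> \bar R}) : Prop :=
  mu (@Zp p) = 1%E /\
  forall (a : QpM p) (A : set (QpM p)), measurable A ->
    mu ((fun y => qp_sub y a) @^-1` A) = mu A.

Definition uniform_pou (R : realType) p
  (mu : {measure set (QpM p) -> \bar R}) (T : set (QpM p)) : Prop :=
  exists f : QpM p -> R,
    (forall x, 0 <= f x) /\ mu.-integrable setT (EFin \o f) /\
    {ae mu, forall x : QpM p, (\esum_(t in T) (f (qp_sub x t))%:E = 1)%E}.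

(* Main.v *)
(* Write N(x) for the number of points of T in the ball B(x, p^n). Integrating
   sum_t f(y - t) = 1 over y in B(x, p^n) and exchanging sum and integral gives
     int f(y) N(x - y) dy = mu(B(0, p^n))   for every x.
   Take n so large that f has more mass in B(0, p^n) than outside it, and call
   these masses a > s. Since N(x - y) = N(x) for y in B(0, p^n), the identity
   first shows that N is bounded; if M and m are its maximum and minimum, then
   taking x where they are attained gives
     M a + m s <= mu(B(0, p^n)) <= m a + M s,
   so M = m. Conversely, if N is constant, then f = 1_{B(0, p^n)} / N works. *)

Require Import Defs.
From HB Require Import structures.
From mathcomp Require Import all_boot all_order all_algebra.
From mathcomp Require Import all_classical all_reals all_analysis.
From mathcomp Require Import finmap measurable_realfun zify ring lra.
Set Implicit Arguments.
Unset Strict Implicit.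
Unset Printing Implicit Defensive.
Import Order.TTheory GRing.Theory Num.Theory numFieldNormedType.Exports.
Local Open Scope ring_scope.
Local Open Scope classical_set_scope.
Local Open Scope card_scope.

(** * Congruences between rationals *)

Section RationalCongruence.
Implicit Types d m q r : rat.

(* As q / 0 = 0, every rational belongs to multiples 0. *)
Definition multiples m : {pred rat} := [pred q | q / m \is a Num.int].

Fact multiples_zmod_closed m : zmod_closed (multiples m).
Proof.
split=> [|q r]; rewrite !inE; first by rewrite mul0r.
by rewrite mulrBl; exact: rpredB.
Qed.

HB.instance Definition _ m :=
  GRing.isZmodClosed.Build rat (multiples m) (multiples_zmod_closed m).

Lemma multiples_refl m : m \in multiples m.
Proof.
by rewrite inE; have [->|m0] := eqVneq m 0; rewrite ?mul0r ?divff// rpred0.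
Qed.

Lemma multiplesS d m : m != 0 -> m \in multiples d ->
  {subset multiples m <= multiples d}.
Proof.
move=> m0 dm q mq; have -> : q = q / m * m by rewrite mulfVK.
by rewrite inE -[_ / d]mulrA; exact: rpredM mq dm.
Qed.

Lemma finite_multiples_itv d b : 0 < d ->
  finite_set [set q | 0 <= q < b /\ q \in multiples d].
Proof.
move=> d0.
apply: sub_finite_set (finite_image (fun j => j%:R * d)
  (finite_II (Num.truncn (b / d)).+1)).
move=> q [/andP[q0 qb]]; rewrite inE intrEge0 ?divr_ge0 ?(ltW d0)//.
move=> /natrP[j qdE]; exists j => /=; last by rewrite -qdE mulfVK ?gt_eqF.
rewrite ltnS truncn_ge_nat ?divr_ge0 ?(ltW d0)//; last by lra.
by rewrite -qdE ler_pM2r ?invr_gt0// ltW.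
Qed.

Lemma modq_sub_multiples m q : m != 0 -> modq q m - q \in multiples m.
Proof. by move=> m0; rewrite /modq addrAC subrr add0r rpredN inE mulfK. Qed.

Lemma mem_modq d m q : m != 0 -> m \in multiples d ->
  (modq q m \in multiples d) = (q \in multiples d).
Proof.
move=> m0 dm; have dr := multiplesS m0 dm (modq_sub_multiples q m0).
by rewrite -[X in _ = X](rpredDl _ dr) subrK.
Qed.

Lemma modq_itv m q : 0 < m -> 0 <= modq q m < m.
Proof.
move=> m0; have /andP[le_floor lt_floor] := floor_itv (q / m).
rewrite /modq subr_ge0 -ler_pdivlMr// le_floor ltrBlDl.
by rewrite -[X in _ + X]mul1r -mulrDl -ltr_pdivrMr// -intrD1.
Qed.

Lemma modq_small m q : 0 <= q < m -> modq q m = q.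
Proof.
move=> /andP[q0 qm]; have m0 : 0 < m := le_lt_trans q0 qm.
rewrite /modq (@floor_def _ (q / m) 0).
  by rewrite mul0r subr0.
by rewrite divr_ge0 ?(ltW m0)//= ltr_pdivrMr ?mul1r.
Qed.

Lemma eq_modq m q r : m != 0 -> q - r \in multiples m -> modq q m = modq r m.
Proof.
rewrite inE => m0 /intrP[i qrE].
have qE : q = r + i%:~R * m by rewrite -qrE mulfVK// addrC subrK.
rewrite /modq qE mulrDl mulfK// floorDrz ?intr_int// intrKfloor.
rewrite intrD; ring.
Qed.

Lemma modq_multiples m q : m != 0 -> q \in multiples m -> modq q m = 0.
Proof.
move=> m0 mq; rewrite (@eq_modq _ _ 0) ?subr0//.
by rewrite /modq mul0r floor0 mul0r subrr.
Qed.

Lemma modqDml m q r : m != 0 -> modq (modq q m + r) m = modq (q + r) m.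
Proof.
move=> m0; apply: eq_modq => //.
by rewrite opprD addrACA subrr addr0 modq_sub_multiples.
Qed.

Lemma modqDmr m q r : m != 0 -> modq (q + modq r m) m = modq (q + r) m.
Proof. by move=> m0; rewrite addrC modqDml// addrC. Qed.

Lemma modqBmr m q r : m != 0 -> modq (q - modq r m) m = modq (q - r) m.
Proof.
move=> m0; apply: eq_modq => //.
have -> : q - modq r m - (q - r) = - (modq r m - r) by ring.
by rewrite rpredN modq_sub_multiples.
Qed.

Lemma denq_dvd q (c : int) : q * c%:~R \is a Num.int -> (denq q %| c)%Z.
Proof.
move=> /intrP[i qcE].
have : (numq q * c)%:~R = (i * denq q)%:~R :> rat.
  by rewrite !intrM numqE -qcE mulrAC.
move=> /intr_inj numqcE.
have : (denq q %| numq q * c)%Z by rewrite numqcE dvdz_mull.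
by rewrite Gauss_dvdzr// /coprimez /gcdz eqz_nat gcdnC; exact: coprime_num_den.
Qed.

End RationalCongruence.

(** * The additive group *)

(* Locked so that unification does not unfold the group laws into residues. *)
HB.lock Definition qp_opp p (x : Qp p) := qp_sub (qp0 p) x.

HB.lock Definition qp_add p (x y : Qp p) := qp_sub x (qp_opp y).

Section Residues.
Variable p : nat.
Implicit Types (q r : rat) (k j : nat) (x y z : Qp p).

Local Notation ppX k := ((pp p ^ k)%:R : rat).

Lemma pp_gt0 : (0 < pp p)%N. Proof. by rewrite leq_max orbT. Qed.

Lemma pp_neq0 : (pp p)%:R != 0 :> rat.
Proof. by rewrite pnatr_eq0 -lt0n pp_gt0. Qed.

Lemma ppX_gt0 k : 0 < ppX k.
Proof. by rewrite ltr0n expn_gt0 pp_gt0. Qed.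

Lemma ppX_neq0 k : ppX k != 0.
Proof. by rewrite gt_eqF ?ppX_gt0. Qed.

Lemma pfrac_int (i : int) : pfrac p i%:~R.
Proof. by rewrite /pfrac denq_int. Qed.

Lemma pfracB q r : pfrac p q -> pfrac p r -> pfrac p (q - r).
Proof.
rewrite /pfrac => pq pr; apply: (@pnat_dvd _ `|denq q * denq r|); last first.
  by rewrite abszM pnatM; apply/andP.
have : (denq (q - r) %| denq q * denq r)%Z.
  apply: denq_dvd.
  have -> : (q - r) * (denq q * denq r)%:~R =
      (numq q * denq r - numq r * denq q)%:~R.
    by rewrite intrD rmorphN/= !intrM !numqE; ring.
  exact: intr_int.
by [].
Qed.

Lemma pfrac_mulX_int q : pfrac p q -> exists j, q * ppX j \is a Num.int.
Proof.
move=> /p_natP[j denqE]; exists j; rewrite -denqE natr_absz normr_denq -numqE.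
exact: intr_int.
Qed.

Lemma res_itv x k : 0 <= res x k < ppX k.
Proof. by have /andP[/and3P[_ -> ->]] := resP x k. Qed.

Lemma pfrac_res x k : pfrac p (res x k).
Proof. by have /andP[/and3P[]] := resP x k. Qed.

Lemma res_inj x y : res x =1 res y -> x = y.
Proof.
case: x y => [a ha] [b hb] /= /funext ab; subst b.
by congr MkQp; exact: Prop_irrelevance.
Qed.

Lemma multiples_ppX k j : (k <= j)%N ->
  {subset multiples (ppX j) <= multiples (ppX k)}.
Proof.
move=> kj; apply: multiplesS; first exact: ppX_neq0.
rewrite inE -(subnKC kj) expnD natrM mulrAC mulfV ?ppX_neq0// mul1r.
exact/intr_nat/rpred_nat.
Qed.

Lemma res_sub_multiples x k j : (k <= j)%N ->
  res x j - res x k \in multiples (ppX k).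
Proof.
move=> /subnKC <-; elim: (j - k)%N => [|i IH].
  by rewrite addn0 subrr rpred0.
rewrite addnS -[res x _.+1](subrK (res x (k + i))) -addrA rpredD//.
by have /andP[_] := resP x (k + i); exact/multiples_ppX/leq_addr.
Qed.

Lemma modq_res x k j : (k <= j)%N -> modq (res x j) (ppX k) = res x k.
Proof.
move=> kj; rewrite (eq_modq (ppX_neq0 k) (res_sub_multiples x kj)).
by rewrite modq_small ?res_itv.
Qed.

Lemma raw_sub_qp_seq x y : qp_seq p (raw_sub x y).
Proof.
move=> k; apply/andP; split.
  rewrite /Defs.canon /raw_sub modq_itv ?ppX_gt0// andbT pfracB//.
    by apply: pfracB; exact: pfrac_res.
  by rewrite pmulrn -intrM; exact: pfrac_int.
change (is_true (raw_sub x y k.+1 - raw_sub x y k \in multiples (ppX k))).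
have -> : raw_sub x y k.+1 - raw_sub x y k =
    (raw_sub x y k.+1 - (res x k.+1 - res y k.+1)) -
    (raw_sub x y k - (res x k - res y k)) +
    ((res x k.+1 - res x k) - (res y k.+1 - res y k)) by ring.
rewrite rpredD// rpredB ?res_sub_multiples//.
  by apply: (multiples_ppX (leqnSn k)); rewrite modq_sub_multiples ?ppX_neq0.
by rewrite modq_sub_multiples ?ppX_neq0.
Qed.

Lemma res_qp_sub x y k : res (qp_sub x y) k = modq (res x k - res y k) (ppX k).
Proof.
by rewrite /qp_sub; case: pselect => // nseq; have := raw_sub_qp_seq x y.
Qed.

Lemma res_qp_opp x k : res (qp_opp x) k = modq (- res x k) (ppX k).
Proof. by rewrite qp_opp.unlock res_qp_sub /= sub0r. Qed.

Lemma res_qp_add x y k : res (qp_add x y) k = modq (res x k + res y k) (ppX k).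
Proof.
by rewrite qp_add.unlock res_qp_sub res_qp_opp modqBmr ?ppX_neq0// opprK.
Qed.

Fact qp_addA : associative (@qp_add p).
Proof.
move=> x y z; apply: res_inj => k; rewrite !res_qp_add.
by rewrite modqDml ?modqDmr ?addrA ?ppX_neq0.
Qed.

Fact qp_addC : commutative (@qp_add p).
Proof. by move=> x y; apply: res_inj => k; rewrite !res_qp_add addrC. Qed.

Fact qp_add0 : left_id (qp0 p) (@qp_add p).
Proof.
by move=> x; apply: res_inj => k; rewrite res_qp_add /= add0r modq_res.
Qed.

Fact qp_addN : left_inverse (qp0 p) (@qp_opp p) (@qp_add p).
Proof.
move=> x; apply: res_inj => k; rewrite res_qp_add res_qp_opp.
by rewrite modqDml ?ppX_neq0// addNr modq_small// lexx ppX_gt0.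
Qed.

HB.instance Definition _ :=
  GRing.isZmodule.Build (Qp p) qp_addA qp_addC qp_add0 qp_addN.

Lemma qp_subE x y : qp_sub x y = x - y.
Proof.
apply: res_inj => k; rewrite -[x - y]/(qp_add x (qp_opp y)).
by rewrite res_qp_add res_qp_opp res_qp_sub modqDmr ?ppX_neq0.
Qed.

Lemma res_sub x y k : res (x - y) k = modq (res x k - res y k) (ppX k).
Proof. by rewrite -qp_subE res_qp_sub. Qed.

End Residues.

(** * Balls *)

Section Balls.
Variable p : nat.
Implicit Types (m n : int) (k j : nat) (x y z t : Qp p).

Local Notation ppz m := ((pp p)%:R ^ m : rat).
Local Notation ppX k := ((pp p ^ k)%:R : rat).

Lemma ppz_nat k : ppz k = ppX k.
Proof. by rewrite natrX. Qed.

Lemma multiples_ppz m n : m <= n ->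
  {subset multiples (ppz n) <= multiples (ppz m)}.
Proof.
move=> mn; apply: multiplesS; first by rewrite expfz_neq0 ?pp_neq0.
rewrite inE invr_expz -expfzDr ?pp_neq0// -[n - m]gez0_abs ?subr_ge0//.
exact/rpredX/intr_nat/rpred_nat.
Qed.

Lemma in_pZ_res m k z : m <= k%:Z ->
  in_pZ p m (res z) <-> res z k \in multiples (ppz m).
Proof.
move=> mk; split=> [/(_ k)//|zk j].
change (is_true (res z j \in multiples (ppz m))).
have [jk|/ltnW kj] := leqP j k; last first.
  rewrite -(subrK (res z k) (res z j)) rpredD//; apply: (multiples_ppz mk).
  by rewrite ppz_nat res_sub_multiples.
have [mj|/ltW jm] := leP m j%:Z.
  rewrite -(subKr (res z k) (res z j)) rpredB//; apply: (multiples_ppz mj).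
  by rewrite ppz_nat res_sub_multiples.
rewrite -(modq_res z jk) modq_multiples ?rpred0 ?ppX_neq0// -ppz_nat.
exact: multiples_ppz zk.
Qed.

Lemma in_pZ0 m : in_pZ p m (res (0 : Qp p)).
Proof. by apply/(@in_pZ_res _ `|m|%N); [lia | exact: rpred0]. Qed.

Lemma in_pZB m x y : in_pZ p m (res x) -> in_pZ p m (res y) ->
  in_pZ p m (res (x - y)).
Proof.
have mk : m <= `|m|%N%:Z by lia.
move=> /(in_pZ_res _ mk) xm /(in_pZ_res _ mk) ym; apply/(in_pZ_res _ mk).
rewrite res_sub mem_modq ?ppX_neq0//; first exact: rpredB.
by apply: (multiples_ppz mk); rewrite ppz_nat multiples_refl.
Qed.

Lemma in_pZW m n z : m <= n -> in_pZ p n (res z) -> in_pZ p m (res z).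
Proof.
move=> mn zn; apply/(@in_pZ_res _ `|n|%N); first by lia.
by apply: (multiples_ppz mn); apply/in_pZ_res => //; lia.
Qed.

Lemma in_pZ_exhaust z : exists k : nat, in_pZ p (- k%:Z) (res z).
Proof.
have [j zj] := pfrac_mulX_int (pfrac_res z 0); exists j.
by apply/(@in_pZ_res _ 0); [lia | rewrite inE -invr_expz invrK ppz_nat].
Qed.

Lemma ballpE x y n : ballp x n y = in_pZ p (- n) (res (x - y)).
Proof.
rewrite (_ : res (x - y) = raw_sub x y)//.
by apply/funext => k; exact: res_sub.
Qed.

Lemma ballp_subl x y t n : ballp (x - t) n y = ballp x n (y + t).
Proof. by rewrite !ballpE opprD addrAC addrA. Qed.

Lemma preimage_addr_ballp x t n :
  (fun y => y + t) @^-1` ballp x n = ballp (x - t) n.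
Proof. by apply/funext => y; rewrite ballp_subl. Qed.

Lemma preimage_addl_ballp x y n :
  (fun t => y + t) @^-1` ballp x n = ballp (x - y) n.
Proof. by apply/funext => t; rewrite ballp_subl addrC. Qed.

Lemma ballpxx x n : ballp x n x.
Proof. by rewrite ballpE subrr; exact: in_pZ0. Qed.

Lemma ballp_sym x y n : ballp x n y -> ballp y n x.
Proof.
by rewrite !ballpE -(opprB x y) -(sub0r (x - y)); apply: in_pZB; exact: in_pZ0.
Qed.

Lemma preimage_subl_ballp x n :
  (fun t => x - t) @^-1` ballp (0 : Qp p) n = ballp x n.
Proof.
apply/funext => t; rewrite /preimage /= propeqE.
split=> [/ballp_sym|xt]; first by rewrite ballp_subl add0r.
by apply/ballp_sym; rewrite ballp_subl add0r.
Qed.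

Lemma ballp_trans y x z n : ballp x n y -> ballp y n z -> ballp x n z.
Proof.
move=> xy /ballp_sym; move: xy; rewrite !ballpE => xy zy.
by rewrite -(subrKA y) -(opprB z y); exact: in_pZB.
Qed.

Lemma ballp_eq x y n : ballp x n y -> ballp x n = ballp y n.
Proof.
move=> xy; apply/seteqP; split => z; last exact: ballp_trans.
exact/ballp_trans/ballp_sym.
Qed.

Lemma ballpW x m n : m <= n -> ballp x m `<=` ballp x n.
Proof. by move=> mn y; rewrite !ballpE; apply: in_pZW; rewrite lerN2. Qed.

Lemma ballp_bigcup : \bigcup_(k : nat) ballp (0 : Qp p) k = setT.
Proof.
apply/seteqP; split => // z _; have [k zk] := in_pZ_exhaust z.
by exists k => //; apply/ballp_sym; rewrite ballpE subr0.
Qed.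

Lemma ballp_res x y k : ballp x (- k%:Z) y <-> res x k = res y k.
Proof.
have Pk0 := ppX_neq0 p k.
rewrite ballpE opprK (@in_pZ_res _ k)// res_sub ppz_nat.
rewrite mem_modq ?multiples_refl//.
split=> [xy|->]; last by rewrite subrr rpred0.
by rewrite -(modq_res x (leqnn k)) (eq_modq Pk0 xy) modq_res.
Qed.

End Balls.

(** * Compactness of balls *)

Section FiniteCover.
Context (T I : Type) (U : I -> set T).

Definition fin_covered (C : set T) : Prop :=
  exists F : set I, finite_set F /\ C `<=` \bigcup_(i in F) U i.

Lemma fin_coveredS (C D : set T) : C `<=` D -> fin_covered D -> fin_covered C.
Proof.
by move=> CD [F [finF DU]]; exists F; split => //; exact: subset_trans DU.
Qed.

Lemma fin_covered_sub1 (C : set T) i : C `<=` U i -> fin_covered C.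
Proof. by move=> CU; exists [set i]; rewrite bigcup_set1; split. Qed.

Lemma fin_covered_bigcup (J : Type) (D : set J) (C : J -> set T) :
  finite_set D -> (forall j, D j -> fin_covered (C j)) ->
  fin_covered (\bigcup_(j in D) C j).
Proof.
move=> finD covC.
have /choice[F FP] : forall j, exists F : set I,
    D j -> finite_set F /\ C j `<=` \bigcup_(i in F) U i.
  move=> j; have [/covC[F ?]|nDj] := pselect (D j); first by exists F.
  by exists set0.
exists (\bigcup_(j in D) F j); split.
  by apply: bigcup_finite => // j /FP[].
move=> y [j Dj Cy]; have [_ /(_ _ Cy)[i Fi Uy]] := FP j Dj.
by exists i => //; exists j.
Qed.

End FiniteCover.

Section Compactness.
Variable p : nat.
Implicit Types (m n : int) (k j : nat) (x y z : Qp p).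

Lemma finite_res_ballp0 n k : - n <= k%:Z ->
  finite_set [set res y k | y in ballp (0 : Qp p) n].
Proof.
move=> nk.
apply: (@sub_finite_set _ _ [set q | 0 <= q < (pp p ^ k)%:R /\
  q \in multiples ((pp p)%:R ^ (- n))]).
  move=> _ [y /ballp_sym y0 <-]; split; first exact: res_itv.
  by apply/in_pZ_res => //; rewrite -(subr0 y) -ballpE.
by apply: finite_multiples_itv; rewrite exprz_gt0// ltr0n pp_gt0.
Qed.

Lemma ballp_totally_bounded x n m : exists F : set (Qp p),
  [/\ finite_set F, F `<=` ballp x n &
      ballp x n `<=` \bigcup_(y in F) ballp y m].
Proof.
pose k := (`|n| + `|m|)%N.
pose r y := res (y - x) k.
have fin_r : finite_set [set r y | y in ballp x n].
  have nk : - n <= k%:Z by rewrite /k; lia.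
  apply: sub_finite_set (finite_res_ballp0 nk) => _ [y xy <-].
  by exists (y - x) => //; rewrite -(subrr x) ballp_subl subrK.
have /choice[g gP] : forall q, exists y,
    [set r y | y in ballp x n] q -> ballp x n y /\ r y = q.
  move=> q; have [[y xy <-]|nq] := pselect ([set r y | y in ballp x n] q).
    by exists y.
  by exists x.
exists [set g q | q in [set r y | y in ballp x n]]; split.
- exact: finite_image.
- by move=> _ [q /gP[xgq _] <-].
- move=> z xz; have rz : [set r y | y in ballp x n] (r z) by exists z.
  exists (g (r z)); first by exists (r z).
  have [_ /ballp_res] := gP _ rz; rewrite ballp_subl subrK.
  by apply: ballpW; rewrite /k; lia.
Qed.

Lemma nested_ballp_point (c : nat -> Qp p) n :
  (forall k, ballp (c k) (n - k%:Z) (c k.+1)) ->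
  exists z, forall k, ballp (c k) (n - k%:Z) z.
Proof.
move=> nested.
have nestedW i j : (i <= j)%N -> ballp (c i) (n - i%:Z) (c j).
  move=> /subnKC <-; elim: (j - i)%N => [|l IH].
    by rewrite addn0; exact: ballpxx.
  by rewrite addnS; apply: ballp_trans IH _; apply: ballpW (nested _); lia.
pose r k := res (c (`|n| + k)%N) k.
have rS k : res (c (`|n| + k.+1)%N) k = r k.
  apply/esym/ballp_res; apply: ballpW (nestedW _ _ _); last by lia.
  by lia.
have r_seq : qp_seq p r.
  move=> k; have /andP[_ int_rS] := resP (c (`|n| + k.+1)%N) k.
  by have /andP[-> _] := resP (c (`|n| + k)%N) k; rewrite -(rS k).
exists (MkQp r_seq) => k; pose j := (k + `|n|)%N.
apply: (@ballp_trans _ (c (`|n| + j)%N)).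
  by apply: nestedW; rewrite /j; lia.
apply/ballp_sym/(@ballpW _ _ (- j%:Z)); first by rewrite /j; lia.
exact/ballp_res.
Qed.

Lemma fin_covered_ballp (I : Type) (U : I -> set (Qp p)) x m n :
  (forall y, ballp x n y -> fin_covered U (ballp y m)) ->
  fin_covered U (ballp x n).
Proof.
move=> cov; have [F [finF Fx /fin_coveredS]] := ballp_totally_bounded x n m.
by apply; apply: fin_covered_bigcup => // y /Fx; exact: cov.
Qed.

(* If no finite subfamily covers the ball, shrinking it repeatedly produces
   nested uncovered balls; their common point lies in a member of the cover,
   which contains one of them. *)
Lemma compactp_ballp x n : compactp (ballp x n).
Proof.
move=> I U openU coverU; apply: contrapT => ncov.
have /choice[step stepP] : forall ky : nat * Qp p, exists z,
    ~ fin_covered U (ballp ky.2 (n - ky.1%:Z)) ->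
    ballp ky.2 (n - ky.1%:Z) z /\ ~ fin_covered U (ballp z (n - ky.1.+1%:Z)).
  move=> [k y] /=; apply: contrapT => /forallNP no_step.
  have ncov_y : ~ fin_covered U (ballp y (n - k%:Z)).
    by move=> cov; apply: (no_step y).
  apply: ncov_y; apply: (@fin_covered_ballp _ _ _ (n - k.+1%:Z)) => z yz.
  by apply: contrapT => ncov_z; apply: (no_step z).
have [c [c0 cS]] : exists c : nat -> Qp p,
    c 0%N = x /\ forall k, c k.+1 = step (k, c k).
  by exists (fix c k := if k is k'.+1 then step (k', c k') else x).
have ncov_c k : ~ fin_covered U (ballp (c k) (n - k%:Z)).
  by elim: k => [|k /(stepP (k, c k))[_]]; rewrite ?c0 ?subr0 ?cS.
have [|z cz] := @nested_ballp_point c n.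
  by move=> k; rewrite cS; have [] := stepP (k, c k) (ncov_c k).
have xz : ballp x n z by rewrite -c0 -(subr0 n); exact: (cz 0%N).
have [i _ Uz] := coverU z xz.
have [m zm] := openU i z Uz.
apply: (ncov_c `|n - m|%N); apply: (@fin_covered_sub1 _ _ _ _ i).
rewrite (ballp_eq (cz _)); apply: subset_trans zm.
by apply: ballpW; lia.
Qed.

End Compactness.

(** * Integration *)

Section CountableSums.
Local Open Scope ereal_scope.
Context d (X : measurableType d) (R : realType) (I : pointedType).
Variables (A : set I) (g : I -> X -> \bar R) (D : set X).
Hypotheses (countableA : countable A) (mg : forall i, measurable_fun D (g i)).
Hypothesis g_ge0 : forall i x, 0 <= g i x.

Lemma esum_countable_nneseries : exists e : nat -> option I,
  forall a : I -> \bar R, (forall i, 0 <= a i) ->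
  \esum_(i in A) a i = \sum_(0 <= k <oo) (if e k is Some i then a i else 0).
Proof.
have /countable_bijP[B] := countableA; rewrite card_eq_sym => /pcard_eqP[e].
exists (fun k => if k \in B then Some (e k) else None) => a a_ge0.
rewrite (reindex_esum B A e); last exact: bij.
rewrite esum_mkcond -nneseries_esumT; last by move=> k; case: ifP.
by apply: eq_eseriesr => k _; case: ifP.
Qed.

Lemma measurable_fun_esum : measurable_fun D (fun x => \esum_(i in A) g i x).
Proof.
have [e eE] := esum_countable_nneseries.
under eq_fun do rewrite eE//.
apply: (@ge0_emeasurable_sum _ _ _ D
  (fun k x => if e k is Some i then g i x else 0) xpredT) => [k x _ _|k _].
  by case: (e k).
by case: (e k) => [i|]; [exact: mg|exact: measurable_cst].
Qed.

Lemma ge0_integral_esum (mu : {measure set X -> \bar R}) : measurable D ->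
  \int[mu]_(x in D) (\esum_(i in A) g i x) =
  \esum_(i in A) \int[mu]_(x in D) g i x.
Proof.
move=> mD; have [e eE] := esum_countable_nneseries.
under eq_integral do rewrite eE//.
rewrite eE; last by move=> i; exact: integral_ge0.
rewrite integral_nneseries//.
- by apply: eq_eseriesr => k _; case: (e k) => //; exact: integral0.
- by move=> k; case: (e k) => [i|]; [exact: mg|exact: measurable_cst].
- by move=> k x _; case: (e k).
Qed.

End CountableSums.

Lemma esum_scaled_indic (R : realType) (I : choiceType) (A T : set I) (c : R) :
  finite_set (A `&` T) -> 0 <= c ->
  \esum_(t in T) (c * \1_A t)%:E = (c * #|` fset_set (A `&` T)|%:R)%:E.
Proof.
move=> finAT c0.
transitivity (\esum_(t in A `&` T) c%:E).
  rewrite esum_mkcondl; apply: eq_esum => t _.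
  by rewrite indicE; case: ifP => _; rewrite ?mulr1 ?mulr0.
rewrite esum_fset// fsbig_finite//= sumEFin -sum1_size natr_sum mulr_sumr.
by under [in RHS]eq_bigr do rewrite mulr1.
Qed.

Section RealIntegrals.
Context d (X : measurableType d) (R : realType).
Variable mu : {measure set X -> \bar R}.

Lemma integrable_indic_lty (A : set X) : measurable A -> (mu A < +oo)%E ->
  mu.-integrable setT (EFin \o (\1_A : X -> R)).
Proof.
move=> mA A_fin; apply/integrableP; split.
  by apply/measurable_EFinP; exact: measurable_indic.
under eq_integral do rewrite /= ger0_norm//.
by rewrite integral_indic// setIT.
Qed.

Variable f : X -> R.
Hypothesis intf : mu.-integrable setT (EFin \o f).

Lemma Rintegral_setC (A : set X) : measurable A ->
  \int[mu]_x f x = \int[mu]_(x in A) f x + \int[mu]_(x in ~` A) f x.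
Proof.
move=> mA; rewrite -Rintegral_setU ?setUv//; first exact: measurableC.
exact/disj_setPCl.
Qed.

Hypothesis f_ge0 : forall x, 0 <= f x.

Lemma ge_Rintegral_mul (h : X -> R) (D : set X) c : measurable D ->
  mu.-integrable setT (EFin \o (fun x => f x * h x)) ->
  (forall x, D x -> c <= h x) ->
  c * \int[mu]_(x in D) f x <= \int[mu]_(x in D) (f x * h x).
Proof.
move=> mD intfh c_le.
have intfD := integrableS measurableT mD (@subsetT _ _) intf.
rewrite mulrC -RintegralZr//; apply: le_Rintegral => //.
- exact: (integrableZr mD c intfD).
- exact: integrableS intfh.
- by move=> x Dx; rewrite ler_wpM2l ?c_le.
Qed.

Lemma le_Rintegral_mul (h : X -> R) (D : set X) c : measurable D ->
  mu.-integrable setT (EFin \o (fun x => f x * h x)) ->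
  (forall x, D x -> h x <= c) ->
  \int[mu]_(x in D) (f x * h x) <= c * \int[mu]_(x in D) f x.
Proof.
move=> mD intfh le_c.
have intfD := integrableS measurableT mD (@subsetT _ _) intf.
rewrite mulrC -RintegralZr//; apply: le_Rintegral => //.
- exact: integrableS intfh.
- exact: (integrableZr mD c intfD).
- by move=> x Dx; rewrite ler_wpM2l ?le_c.
Qed.

Lemma exhaustion_integral_setC_lt (F : nat -> set X) :
  {homo F : m n / (m <= n)%N >-> m `<=` n} -> (forall k, measurable (F k)) ->
  \bigcup_k F k = setT -> 0 < \int[mu]_x f x ->
  exists k, \int[mu]_(x in ~` F k) f x < \int[mu]_(x in F k) f x.
Proof.
move=> ndF mF FT If_gt0.
have cvgF : \int[mu]_(x in F k) f x @[k --> \oo] --> \int[mu]_x f x.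
  apply: fine_cvg; rewrite fineK; last exact: integrable_fin_num.
  rewrite -FT; apply: ge0_nondecreasing_set_cvg_integral => //.
  - by move=> m n mn; rewrite subsetEset; exact: ndF.
  - by move=> k; apply: measurable_funTS; exact: measurable_int intf.
  - by move=> k x _; rewrite lee_fin.
have half_lt : 2^-1 * \int[mu]_x f x < \int[mu]_x f x by lra.
have [k _ /(_ k (leqnn k)) /= gt_half] := cvgr_gt _ cvgF _ half_lt.
by exists k; move: gt_half; rewrite (Rintegral_setC (mF k)); lra.
Qed.

End RealIntegrals.

(** * Haar measure *)

Section Haar.
Context (R : realType) (p : nat).
Implicit Types (x y z t : QpM p) (n : int).

Lemma measurable_ballp x n : measurable (ballp x n : set (QpM p)).
Proof. by apply: sub_sigma_algebra; exists x, n. Qed.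

Lemma measurable_addr t :
  measurable_fun [set: QpM p] (fun y : QpM p => y + t : QpM p).
Proof.
apply: (@measurability _ _ (QpM p) (QpM p) setT _ (@balls p)) => //.
move=> _ [_ [x [n ->]] <-].
by rewrite setTI preimage_addr_ballp; exact: measurable_ballp.
Qed.

Variable mu : {measure set (QpM p) -> \bar R}.
Hypothesis haar_mu : haar_normalized mu.

Lemma haar_preimage_addr t (A : set (QpM p)) : measurable A ->
  mu ((fun y => y + t) @^-1` A) = mu A.
Proof.
move=> mA; rewrite -[RHS](haar_mu.2 (- t) A mA).
rewrite (_ : (fun y => qp_sub y (- t)) = (fun y => y + t))//.
by apply/funext => y; rewrite qp_subE opprK.
Qed.

Lemma haar_ballp x n : mu (ballp x n) = mu (ballp (0 : QpM p) n).
Proof.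
rewrite -(haar_preimage_addr x (measurable_ballp x n)) preimage_addr_ballp.
by rewrite subrr.
Qed.

Lemma haar_ballp_lty x n : (mu (ballp x n) < +oo)%E.
Proof.
have [F [finF _ xF]] := ballp_totally_bounded x n 0.
have mF := measurable_ballp.
apply: (@le_lt_trans _ _ (\sum_(y \in F) mu (ballp y 0))%E).
  exact: content_sub_fsum.
rewrite fsbig_finite//=; apply/lte_sum_pinfty => y _.
by rewrite haar_ballp [mu _]haar_mu.1 ltry.
Qed.

Lemma haar_integral_addr t (g : QpM p -> \bar R) :
  measurable_fun setT g -> (forall y, (0 <= g y)%E) ->
  (\int[mu]_y g (y + t)%R = \int[mu]_y g y)%E.
Proof.
move=> mg g_ge0.
have /= := ge0_integral_pushforward (measurable_addr t) mu measurableT mg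
  (fun y _ => g_ge0 y).
rewrite preimage_setT => <-.
apply: eq_measure_integral => [|mphi A mA _]; first exact: measurable_addr.
exact: haar_preimage_addr.
Qed.

End Haar.

(** * Partitions of unity *)

Section BallCount.
Variables (p : nat) (T : set (QpM p)).
Hypothesis lfT : locally_finite T.
Implicit Types (x y : QpM p) (n : int).

Lemma finite_ballpI x n : finite_set (ballp x n `&` T).
Proof. exact/lfT/compactp_ballp. Qed.

Lemma locally_finite_countable : countable T.
Proof.
rewrite -(setTI T) -ballp_bigcup setI_bigcupl.
apply: bigcup_countable => // k _; exact/finite_set_countable/finite_ballpI.
Qed.

Definition ball_count n x : nat := #|` fset_set (ballp x n `&` T)|.

Lemma card_ballpI_eq n x y :
  (ballp x n `&` T) #= (ballp y n `&` T) <-> ball_count n x = ball_count n y.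
Proof. by split=> [/fcard_eq|/fcard_eq]; apply; exact: finite_ballpI. Qed.

Lemma ball_count_gt0 n x : T x -> (0 < ball_count n x)%N.
Proof.
move=> Tx; rewrite cardfs_gt0; apply/fset0Pn; exists x.
rewrite in_fset_set; last exact: finite_ballpI.
by apply/mem_set; split => //; exact: ballpxx.
Qed.

Lemma ball_count_eq n x y : ballp x n y -> ball_count n x = ball_count n y.
Proof. by rewrite /ball_count => /ballp_eq ->. Qed.

End BallCount.

Lemma constant_of_mean_value (R : archiRealFieldType) (X : Type) (N : X -> nat)
    (a s v : R) (r : X -> R) :
  0 <= s < a -> (forall x, v = (N x)%:R * a + r x) ->
  (forall c, (forall y, c <= N y)%N -> forall x, c%:R * s <= r x) ->
  (forall c, (forall y, N y <= c)%N -> forall x, r x <= c%:R * s) ->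
  forall x y, N x = N y.
Proof.
move=> /andP[s0 sa] vE r_ge r_le x y; have a0 : 0 < a := le_lt_trans s0 sa.
pose value := [pred i : nat | `[< exists z, N z = i >]].
have value_ex : exists i, value i by exists (N x); apply/asboolP; exists x.
have value_le i : value i -> (i <= Num.truncn (v / a))%N.
  move=> /asboolP[z <-]; rewrite -ltnS -(ltr_nat R).
  apply: le_lt_trans (truncnS_gt _); rewrite ler_pdivlMr// (vE z) lerDl.
  by have := r_ge 0%N (fun=> leq0n _) z; rewrite mul0r.
have [M /asboolP[xM NM] leM] := ex_maxnP value_ex value_le.
have [m /asboolP[xm Nm] gem] := ex_minnP value_ex.
have NleM z : (N z <= M)%N by apply: leM; apply/asboolP; exists z.
have mleN z : (m <= N z)%N by apply: gem; apply/asboolP; exists z.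
have Mm : (M <= m)%N.
  have := r_ge m mleN xM; have := r_le M NleM xm.
  have := vE xM; have := vE xm; rewrite NM Nm -(ler_nat R) => vm vM r_xm r_xM.
  rewrite -subr_le0 -(pmulr_lle0 _ (_ : 0 < a - s)) ?subr_gt0//; lra.
by apply/eqP; rewrite eqn_leq !(leq_trans (NleM _) (leq_trans Mm (mleN _))).
Qed.

Section PartitionOfUnity.
Context (R : realType) (p : nat).
Variable mu : {measure set (QpM p) -> \bar R}.
Hypothesis haar_mu : haar_normalized mu.
Variable T : set (QpM p).
Hypothesis lfT : locally_finite T.
Implicit Types (x y z t : QpM p) (n : int).

Local Notation ball0 := (ballp (0 : QpM p)).

Definition unit_translates (f : QpM p -> R) : Prop :=
  {ae mu, forall x, (\esum_(t in T) (f (x - t)%R)%:E = 1)%E}.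

Lemma uniform_pouE : uniform_pou mu T <-> exists f : QpM p -> R,
  [/\ forall x, 0 <= f x, mu.-integrable setT (EFin \o f) & unit_translates f].
Proof.
have sumE (f : QpM p -> R) x : (\esum_(t in T) (f (qp_sub x t))%:E =
    \esum_(t in T) (f (x - t)%R)%:E)%E.
  by apply: eq_esum => t _; rewrite qp_subE.
split=> [[f [f_ge0 [intf sumf]]]|[f [f_ge0 intf sumf]]]; exists f; split => //.
  by apply: filterS sumf => x; rewrite sumE.
by split => //; apply: filterS sumf => x; rewrite sumE.
Qed.

Lemma const_ball_count_uniform_pou n : T !=set0 ->
  (forall x y, ball_count T n x = ball_count T n y) -> uniform_pou mu T.
Proof.
move=> [t0 Tt0] constN; set c := ball_count T n t0.
have c_neq0 : c%:R != 0 :> R by rewrite pnatr_eq0 -lt0n; exact: ball_count_gt0.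
apply/uniform_pouE; exists (fun x => c%:R^-1 * \1_(ball0 n) x); split.
- by move=> x; rewrite mulr_ge0 ?invr_ge0.
- rewrite -[EFin \o _]/(fun x => (c%:R^-1)%:E * (\1_(ball0 n) x)%:E)%E.
  apply: integrableZl => //.
  apply: integrable_indic_lty; first exact: measurable_ballp.
  exact: haar_ballp_lty.
- apply: aeW => x.
  rewrite (eq_esum (b := fun t => (c%:R^-1 * \1_(ballp x n) t)%:E)); last first.
    by move=> t _; rewrite -(preimage_subl_ballp x n).
  rewrite esum_scaled_indic ?invr_ge0//; last exact: finite_ballpI.
  by rewrite -/(ball_count T n x) (constN x t0) mulVf.
Qed.

Section Necessity.
Variable f : QpM p -> R.
Hypotheses (f_ge0 : forall x, 0 <= f x) (sumf : unit_translates f).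
Hypothesis intf : mu.-integrable setT (EFin \o f).

Let mf : measurable_fun [set: QpM p] f.
Proof. by apply/measurable_EFinP; exact: measurable_int intf. Qed.

Let countableT : countable T.
Proof. exact: locally_finite_countable. Qed.

Let mul_indic_ge0 (A : set (QpM p)) x y : (0 <= (f x * \1_A y)%:E)%E.
Proof. by rewrite lee_fin mulr_ge0. Qed.

Lemma measurable_mul_translate (A : set (QpM p)) t : measurable A ->
  measurable_fun setT (fun y => (f y * \1_A (y + t))%:E).
Proof.
move=> mA; apply/measurable_EFinP; apply: measurable_funM => //.
have m1A : measurable_fun setT (\1_A : QpM p -> R) by exact: measurable_indic.
exact: measurableT_comp m1A (measurable_addr t).
Qed.

Lemma integral_esum_translates (A : set (QpM p)) : measurable A ->
  (\int[mu]_y (\esum_(t in T) (f y * \1_A (y + t)%R)%:E) = mu A)%E.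
Proof.
move=> mA; pose g t y := (f y * \1_A (y + t))%:E.
have mg t : measurable_fun setT (g t) := measurable_mul_translate t mA.
have gE t y : g t (y - t) = (f (y - t) * \1_A y)%:E by rewrite /g subrK.
have mg_sub t : measurable_fun setT (fun y => g t (y - t)).
  exact: measurableT_comp (mg t) (measurable_addr (- t)).
have g_ge0 t y : (0 <= g t y)%E := mul_indic_ge0 A y (y + t).
have g_sub_ge0 t y : (0 <= g t (y - t)%R)%E := g_ge0 t _.
rewrite (ge0_integral_esum countableT mg g_ge0)//.
transitivity (\esum_(t in T) \int[mu]_y g t (y - t)%R)%E.
  by apply: eq_esum => t _; rewrite (haar_integral_addr haar_mu _ (mg t)).
rewrite -(ge0_integral_esum countableT mg_sub g_sub_ge0)//.
rewrite -[in RHS](setIT A) -integral_indic//; apply: ge0_ae_eq_integral => //.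
- by apply: measurable_fun_esum => // t y; exact: mul_indic_ge0.
- by apply/measurable_EFinP; exact: measurable_indic.
- by move=> y _; apply: esum_ge0 => t _; exact: mul_indic_ge0.
apply: filterS sumf => y sumfy _; under eq_esum do rewrite gE.
rewrite indicE; case: (y \in A) => /=; last first.
  by rewrite esum1// => t _; rewrite mulr0.
by under eq_esum do rewrite mulr1.
Qed.

Lemma esum_translates_ballp n x y :
  (\esum_(t in T) (f y * \1_(ballp x n) (y + t)%R)%:E =
   (f y * (ball_count T n (x - y))%:R)%:E)%E.
Proof.
rewrite -esum_scaled_indic//; last exact: finite_ballpI.
by apply: eq_esum => t _; rewrite -preimage_addl_ballp.
Qed.

Lemma integral_mul_ball_count n x :
  (\int[mu]_y (f y * (ball_count T n (x - y)%R)%:R)%:E =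
   mu (ball0 n))%E.
Proof.
under eq_integral do rewrite -esum_translates_ballp.
by rewrite integral_esum_translates ?haar_ballp//; exact: measurable_ballp.
Qed.

Lemma integrable_mul_ball_count n x :
  mu.-integrable setT (EFin \o (fun y => f y * (ball_count T n (x - y))%:R)).
Proof.
apply/integrableP; split.
  rewrite (_ : _ \o _ =
    fun y => \esum_(t in T) (f y * \1_(ballp x n) (y + t)%R)%:E)%E.
    apply: measurable_fun_esum => [//|t|t y]; last exact: mul_indic_ge0.
    by apply: measurable_mul_translate; exact: measurable_ballp.
  by apply/funext => y; rewrite esum_translates_ballp.
under eq_integral do rewrite /= ger0_norm ?mulr_ge0//.
by rewrite integral_mul_ball_count; exact: haar_ballp_lty.
Qed.

Lemma Rintegral_unit_translates_gt0 : 0 < \int[mu]_y f y.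
Proof.
rewrite lt_neqAle Rintegral_ge0// andbT eq_sym; apply/negP => /eqP If0.
have f_ae0 : ae_eq mu setT (EFin \o f) (cst 0%E).
  apply/ae_eq_integral_abs => //; first exact/measurable_EFinP.
  under eq_integral do rewrite /= ger0_norm//.
  by rewrite -[LHS]fineK ?(integrable_fin_num _ intf)// [fine _]If0.
have mZ : measurable (@Defs.Zp p : set (QpM p)) := measurable_ballp _ _.
have : (mu (@Defs.Zp p) = 0)%E.
  rewrite -(integral_esum_translates mZ) -(integral0 mu setT).
  apply: ge0_ae_eq_integral => //.
  - by apply: measurable_fun_esum => // t; exact: measurable_mul_translate.
  - by move=> y _; apply: esum_ge0 => t _; exact: mul_indic_ge0.
  apply: filterS f_ae0 => y /(_ I)[f0] _; apply: esum1 => t _.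
  by rewrite f0 mul0r.
by rewrite haar_mu.1 => /eqP; rewrite onee_eq0.
Qed.

Lemma mean_ball_count n x :
  fine (mu (ball0 n)) =
  (ball_count T n x)%:R * \int[mu]_(y in ball0 n) f y +
  \int[mu]_(y in ~` ball0 n) (f y * (ball_count T n (x - y))%:R).
Proof.
have mB : measurable (ball0 n : set (QpM p)) := measurable_ballp _ _.
have intfB : mu.-integrable (ball0 n) (EFin \o f).
  exact: integrableS intf.
have near_x :
    \int[mu]_(y in ball0 n) (f y * (ball_count T n (x - y))%:R) =
    (ball_count T n x)%:R * \int[mu]_(y in ball0 n) f y.
  rewrite mulrC -(RintegralZr _ mB intfB).
  apply: eq_Rintegral => y /set_mem By; congr (_ * _%:R).
  by apply: ball_count_eq; rewrite ballp_subl addrC -ballp_subl subrr.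
rewrite -near_x -(Rintegral_setC (integrable_mul_ball_count n x) mB).
by rewrite -(integral_mul_ball_count n x).
Qed.

Lemma unit_translates_const_ball_count : exists n, forall x y,
  ball_count T n x = ball_count T n y.
Proof.
have [|k|||k far_lt_near] := @exhaustion_integral_setC_lt _ _ _ mu f intf f_ge0
  (fun k => ball0 k%:Z).
- by move=> m n mn; apply: ballpW; lia.
- exact: measurable_ballp.
- exact: ballp_bigcup.
- exact: Rintegral_unit_translates_gt0.
have mBC : measurable (~` ball0 k%:Z : set (QpM p)).
  by apply: measurableC; exact: measurable_ballp.
exists k%:Z.
apply: (constant_of_mean_value (s := \int[mu]_(y in ~` ball0 k%:Z) f y)
  _ (mean_ball_count k)).
- by rewrite Rintegral_ge0.
- move=> c Nc x; apply: ge_Rintegral_mul => // [|y _]; last by rewrite ler_nat.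
  exact: integrable_mul_ball_count.
- move=> c Nc x; apply: le_Rintegral_mul => // [|y _]; last by rewrite ler_nat.
  exact: integrable_mul_ball_count.
Qed.

End Necessity.
End PartitionOfUnity.

Theorem theorem1p2 (R : realType) (p : nat) (hp : prime p)
  (mu : {measure set (QpM p) -> \bar R}) (hmu : haar_normalized mu)
  (T : set (QpM p)) (hT0 : T !=set0) (hTlf : locally_finite T) :
  uniform_pou mu T <->
  exists n : int, forall x y : QpM p,
    (ballp x n `&` T) #= (ballp y n `&` T).
Proof.
split=> [/uniform_pouE[f [f_ge0 intf sumf]]|[n card_eq]].
  have [n constN] := unit_translates_const_ball_count hmu hTlf f_ge0 sumf intf.
  by exists n => x y; apply/card_ballpI_eq.
apply: (const_ball_count_uniform_pou hmu hTlf (n := n)) => // x y.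
exact/card_ballpI_eq.
Qed.
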